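(* For real $s>0$ and complex $w$ with $|w|<1$, $$H_s(w)=1-\sum_{n=1}^{\infty}q_{s,n}w^n,$$ where, for every $n\ge1$, $$q_{s,n}=\sum_{k=1}^{n}\frac{(-1)^{k+1}}{(2k+1)^s}\binom{n-1}{k-1}=\frac1{\Gamma(s)}\int_0^1x^2(1-x^2)^{n-1}(-\log x)^{s-1}\,dx.$$ In particular, $q_{s,n}>0$ for all $s>0$ and $n\ge1$.
   Context: For real $s>0$, $F_s$ denotes the analytic function on the half-plane $\operatorname{Re}t>-1$ given by $$F_s(t)=\frac1{\Gamma(s)}\int_0^1\frac{(-\log x)^{s-1}}{1+tx^2}\,dx;$$ it is the analytic extension of $\sum_{k=0}^\infty\frac{(-1)^kt^k}{(2k+1)^s}$, $|t|<1$. For $|w|<1$, $H_s(w)=F_s\!\left(\frac{w}{1-w}\right)$. *)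

(* Defs.v *)
From mathcomp Require Export all_boot all_order all_algebra.
From mathcomp Require Export complex.
From mathcomp Require Export all_classical all_reals all_analysis.
Export Order.TTheory GRing.Theory Num.Theory.
Export numFieldNormedType.Exports.

#[export] Set Implicit Arguments.
#[export] Unset Strict Implicit.
#[export] Unset Printing Implicit Defensive.

Local Open Scope ring_scope.
Local Open Scope classical_set_scope.
Local Open Scope complex_scope.

Section Defs.
Context {R : realType}.
Implicit Types (s : R) (t w : R[i]) (n : nat).

Local Notation mu := (@lebesgue_measure R).

(* Euler's Gamma function, for a real argument s > 0. *)
Definition Gamma s : R :=
  \int[mu]_(u in `]0, +oo[) (u `^ (s - 1) * expR (- u)).

(* Lebesgue integral of a complex-valued function of a real variable. *)
Definition Cintegral (D : set R) (f : R -> R[i]) : R[i] :=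
  (\int[mu]_(x in D) complex.Re (f x)) +i* (\int[mu]_(x in D) complex.Im (f x)).

(* Meant for s > 0 and -1 < Re t.  The interval is open because ln and powR
   take conventional values at the endpoints, which are null sets. *)
Definition F s t : R[i] :=
  ((Gamma s)^-1)%:C *
  Cintegral `]0, 1[ (fun x => ((- ln x) `^ (s - 1))%:C / (1 + t * (x ^+ 2)%:C)).

Definition H s w : R[i] := F s (w / (1 - w)).

Definition q s n : R :=
  \sum_(1 <= k < n.+1)
    (-1) ^+ k.+1 / ((2 * k + 1)%:R `^ s) * 'C(n.-1, k.-1)%:R.

End Defs.

(* Main.v *)
Require Import Defs.
From mathcomp Require Import ring lra measurable_realfun.

(** The argument rests on one positive weight, (- ln x)^(s-1) on ]0, 1[, and
    on a geometric series in w.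

    Put y = 1 - x^2.  With t = w / (1 - w) the kernel of F becomes
      1 / (1 + t x^2) = (1 - w) / (1 - w y) = 1 - w x^2 / (1 - w y),
    and the last fraction expands as the sum of the w^n x^2 y^(n-1) for n >= 1,
    because |w y| < 1 on ]0, 1[.  Integrating against the weight and dividing
    by Gamma s turns x^2 y^(n-1) into the coefficient q s n.  The interchange
    of sum and integral needs no limit theorem: the series cut after n terms
    leaves the remainder w^(n+1) x^2 y^n / (1 - w y) ([geometric_tail]), which
    is at most |w|^(n+1) / (1 - |w|) uniformly in x, so that its weighted
    integral tends to 0 ([norm_tail_integral]).

    The two expressions for q s n agree because the moments of the weight are
      int_0^1 x^p (- ln x)^(s-1) dx = Gamma s / (p+1)^s
    ([logweight_moment]): expand (1 - x^2)^(n-1) by the binomial theorem.  The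
    moments come from the substitution x = exp (- u / (p+1)), which turns the
    integral into a multiple of that of Gamma.  As both integrals are improper
    at both ends, they are computed as limits over the compact intervals
    [1/(n+1), n+1] and their images ([substitution_exp]).

    Gamma is defined by a real-valued integral, so its convergence has to be
    proved; it is compared with the derivative of (u / (1+u))^s, a bounded
    function ([gamma_integral_lty]).  Finally, Gamma s and the q s n are
    positive as integrals of positive functions over an interval
    ([Rintegral_gt0]). *)

Local Open Scope ring_scope.
Local Open Scope classical_set_scope.
Local Open Scope complex_scope.

(** * Integrals over open intervals, by exhaustion *)

Section Exhaustion.
Context {R : realType}.
Local Notation mu := (@lebesgue_measure R).

Let A (n : nat) : set R := `[n.+1%:R^-1, n.+1%:R].

Lemma exhaust_nondecreasing : nondecreasing_seq A.
Proof.
move=> m n mn; apply/subsetPset => x; rewrite /A /= !in_itv/= => /andP[h1 h2].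
have h : (m.+1%:R : R) <= n.+1%:R by rewrite ler_nat ltnS.
rewrite (le_trans h2 h) andbT (le_trans _ h1)// lef_pV2 ?posrE//.
Qed.

Lemma exhaust_bigcup : \bigcup_n A n = `]0, +oo[.
Proof.
apply/seteqP; split => x; rewrite /A /=.
  move=> [n _] /=; rewrite !in_itv/= andbT => /andP[h _].
  by apply: lt_le_trans h; rewrite invr_gt0.
rewrite in_itv/= andbT => x0.
(* A bound n + 1 > x + 1/x serves for both x and 1/x. *)
exists (Num.trunc (x + x^-1)) => //=; rewrite in_itv/=.
have h := truncnS_gt (x + x^-1).
apply/andP; split.
  rewrite -[leRHS]invrK lef_pV2 ?posrE ?invr_gt0// ltW// (le_lt_trans _ h)//.
  by rewrite lerDr ltW.
by rewrite ltW// (le_lt_trans _ h)// lerDl invr_ge0 ltW.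
Qed.

(** The substitution x = exp (- c u).  The substitution theorem for compact
    intervals applies on each [1/(n+1), n+1], where G is continuous; both
    sides are the limits of these integrals, since the intervals exhaust
    ]0, +oo[ and their images exhaust ]0, 1[. *)
Lemma substitution_exp (c : R) (G : R -> R) : 0 < c ->
  (forall x : R, 0 < x < 1 -> {for x, continuous G}) ->
  (forall x, 0 < x < 1 -> 0 <= G x) ->
  (\int[mu]_(x in `]0%R, 1%R[) (G x)%:E =
   \int[mu]_(u in `]0%R, +oo[)
     (G (expR (- c * u)) * (c * expR (- c * u)))%:E)%E.
Proof.
move=> c0 cG G0.
pose F (u : R) : R := expR (- c * u).
have F0 (u : R) : 0 < F u by exact: expR_gt0.
have F1 (u : R) : 0 < u -> F u < 1.
  by move=> u0; rewrite /F expR_lt1 mulNr oppr_lt0 mulr_gt0.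
have Fdecr (x y : R) : x < y -> F y < F x.
  by move=> xy; rewrite ltr_expR !mulNr ltrN2 ltr_pM2l.
have Fle (x y : R) : x <= y -> F y <= F x.
  by move=> xy; rewrite ler_expR !mulNr lerN2 ler_pM2l.
have dF (x : R) : is_derive x 1 F (- (c * F x)).
  rewrite /F; apply: is_derive_eq.
  by rewrite /GRing.scale/= mulr1; ring.
have dF1 : F^`() = fun x : R => - (c * F x).
  by apply/funext => x; rewrite derive1E; apply: derive_val.
have cF : continuous F.
  move=> x; apply/differentiable_continuous/derivable1_diffP.
  exact: ex_derive.
have cF' : continuous F^`().
  by rewrite dF1 => x; apply: cvgN; apply: cvgM; [exact: cvg_cst|exact: cF].
pose B n : set R := `[F n.+1%:R, F n.+1%:R^-1].
have BE : \bigcup_n B n = `]0, 1[.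
  apply/seteqP; split => x; rewrite /B /=.
    move=> [n _] /=; rewrite !in_itv/= => /andP[h1 h2].
    by rewrite (lt_le_trans _ h1)//= (le_lt_trans h2)// F1.
  rewrite in_itv/= => /andP[x0 x1].
  pose u := - ln x / c.
  have u0 : 0 < u by rewrite divr_gt0// oppr_gt0 ln_lt0// x0.
  have xE : x = F u.
    by rewrite /F (_ : - c * u = ln x) ?lnK// /u; field; rewrite gt_eqF.
  have : u \in `]0, +oo[%classic by rewrite inE/= in_itv/= u0.
  rewrite -exhaust_bigcup inE => -[n _]; rewrite /A/= in_itv/= => /andP[h1 h2].
  by exists n => //=; rewrite in_itv/= xE !Fle.
have ABsub n x : A n x -> 0 < x.
  rewrite /A/= in_itv/= => /andP[h _].
  by apply: lt_le_trans h; rewrite invr_gt0.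
have Bsub n : B n `<=` `]0, 1[ by rewrite -BE; exact: bigcup_sup.
have Asub n : A n `<=` `]0, +oo[ by rewrite -exhaust_bigcup; exact: bigcup_sup.
have mB : measurable_fun (`]0, 1[ : set R) G.
  by apply: open_continuous_measurable_fun => // x;
    rewrite inE/= in_itv/= => /cG.
have mA : measurable_fun (`]0, +oo[ : set R) (fun u => G (F u) * (c * F u)).
  apply: open_continuous_measurable_fun => // x.
  rewrite inE/= in_itv/= andbT => x0; apply: cvgM.
    apply: (@continuous_comp _ _ _ F G); first exact: cF.
    by apply: cG; rewrite F0 F1.
  by apply: cvgM; [exact: cvg_cst|exact: cF].
have hB : (\int[mu]_(x in B n) (G x)%:E)%E @[n --> \oo] -->
          (\int[mu]_(x in `]0%R, 1%R[) (G x)%:E)%E.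
  rewrite -BE; apply: ge0_nondecreasing_set_cvg_integral.
  - move=> m n mn; apply/subsetPset => x; rewrite /B/= !in_itv/=.
    have hmn : (m.+1%:R : R) <= n.+1%:R by rewrite ler_nat ltnS.
    move=> /andP[h1 h2]; rewrite (le_trans _ h1) ?Fle//= (le_trans h2)// Fle//.
    by rewrite lef_pV2 ?posrE.
  - by move=> n; exact: measurable_itv.
  - by move=> n; apply/measurable_EFinP; apply: measurable_funS (Bsub n) mB.
  - by move=> n x /Bsub/=; rewrite in_itv/= lee_fin => /G0.
have hA : (\int[mu]_(x in A n) (G (F x) * (c * F x))%:E)%E @[n --> \oo] -->
          (\int[mu]_(x in `]0%R, +oo[) (G (F x) * (c * F x))%:E)%E.
  rewrite -exhaust_bigcup; apply: ge0_nondecreasing_set_cvg_integral.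
  - exact: exhaust_nondecreasing.
  - by move=> n; exact: measurable_itv.
  - by move=> n; apply/measurable_EFinP; apply: measurable_funS (Asub n) mA.
  - move=> n x /ABsub x0; rewrite lee_fin !mulr_ge0 ?(ltW c0) ?(ltW (F0 _))//.
    by apply: G0; rewrite F0 F1.
rewrite -(cvg_lim _ hA)// -(cvg_lim _ hB)//.
apply: congr_lim; apply/funext => n.
rewrite /B integration_by_substitution_decreasing.
- by apply: eq_integral => x _; rewrite /= dF1 opprK.
- by rewrite (@le_trans _ _ 1)// ?invf_le1// ler1n.
- by move=> x y _ _; exact: Fdecr.
- by move=> x _; exact: cF'.
- by apply: cvgP; apply: cvg_at_right_filter; exact: cF'.
- by apply: cvgP; apply: cvg_at_left_filter; exact: cF'.
- split; first by move=> x _; exact: ex_derive.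
  + by apply: cvg_at_right_filter; exact: cF.
  + by apply: cvg_at_left_filter; exact: cF.
- apply: continuous_in_subspaceT => x; rewrite inE => /Bsub xB.
  by apply: cG; move: xB; rewrite /= in_itv.
Qed.

(** On each compact interval the integral of f is a difference of two values
    of g, both of them in [0, M]; the bound passes to the limit. *)
Lemma integral_le_primitive_bound (f g : R -> R) (M : R) :
  (forall x : R, 0 < x -> {for x, continuous f}) ->
  (forall x, 0 < x -> 0 <= f x) ->
  (forall x : R, 0 < x -> is_derive x 1 g (f x)) ->
  (forall x, 0 < x -> 0 <= g x <= M) ->
  (\int[mu]_(x in `]0%R, +oo[) (f x)%:E <= M%:E)%E.
Proof.
move=> cf f0 dg gM.
have ABsub n x : A n x -> 0 < x.
  rewrite /A/= in_itv/= => /andP[h _].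
  by apply: lt_le_trans h; rewrite invr_gt0.
have Asub n : A n `<=` `]0, +oo[ by rewrite -exhaust_bigcup; exact: bigcup_sup.
have cg (x : R) : 0 < x -> {for x, continuous g}.
  move=> x0; apply/differentiable_continuous/derivable1_diffP.
  by have [] := dg _ x0.
have hA : (\int[mu]_(x in A n) (f x)%:E)%E @[n --> \oo] -->
          (\int[mu]_(x in `]0%R, +oo[) (f x)%:E)%E.
  rewrite -exhaust_bigcup; apply: ge0_nondecreasing_set_cvg_integral.
  - exact: exhaust_nondecreasing.
  - by move=> n; exact: measurable_itv.
  - move=> n; apply/measurable_EFinP; apply: (measurable_funS _ (Asub n)) => //.
    apply: open_continuous_measurable_fun => // x.
    by rewrite inE/= in_itv/= andbT => /cf.
  - by move=> n x /ABsub x0; rewrite lee_fin f0.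
rewrite -(cvg_lim _ hA)//; apply: lime_le.
  by apply/cvg_ex; eexists; exact: hA.
apply: nearW => -[|n].
  (* The first interval is the point 1. *)
  by rewrite /A invr1 set_itv1 integral_set1 lee_fin;
    have /andP[h1 h2] := gM 1 ltr01; exact: le_trans h2.
have n1 : n.+2%:R^-1 < n.+2%:R :> R.
  by rewrite (@lt_trans _ _ 1)// ?invf_lt1// ltr1n.
have n0 : 0 < n.+2%:R^-1 :> R by rewrite invr_gt0.
rewrite /A (@continuous_FTC2 _ f g)//.
- rewrite -EFinB lee_fin.
  have /andP[h1 _] := gM _ n0.
  have /andP[_ h2] : 0 <= g n.+2%:R <= M by apply: gM.
  by rewrite lerBlDr (le_trans h2)// lerDl.
- apply: continuous_in_subspaceT => x; rewrite inE => /Asub /=.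
  by rewrite in_itv/= andbT => /cf.
- split.
  + move=> x; rewrite in_itv/= => /andP[h _].
    by have [] := dg _ (lt_trans n0 h).
  + exact/cvg_at_right_filter/cg.
  + exact/cvg_at_left_filter/cg.
- move=> x; rewrite in_itv/= => /andP[h _].
  by rewrite derive1E; have [] := dg _ (lt_trans n0 h).
Qed.

End Exhaustion.

(** * Convergence of Gamma and the moments of the logarithmic weight *)

Section LogWeight.
Context {R : realType}.
Local Notation mu := (@lebesgue_measure R).
Variable s : R.
Hypothesis s0 : 0 < s.

Let g (u : R) : R := u `^ (s - 1) * expR (- u).

Lemma continuous_powR (a x : R) : 0 < x ->
  {for x, continuous (fun u : R => u `^ a)}.
Proof.
move=> x0; apply/differentiable_continuous/derivable1_diffP.
by apply: derivable_powR; rewrite in_itv/= x0.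
Qed.

Lemma measurable_gamma_integrand : measurable_fun (`]0, +oo[ : set R) g.
Proof.
apply: measurable_funM; first by
  apply: measurable_funTS; exact: measurable_powR.
by apply: measurable_funTS; apply: measurableT_comp.
Qed.

Lemma is_derive_ln1p (x : R) : 0 < 1 + x ->
  is_derive x (1 : R) (fun u : R => ln (1 + u)) (1 + x)^-1.
Proof.
move=> x10.
have d1 : is_derive x 1 (fun u : R => 1 + u) 1.
  have : is_derive x 1 ((fun u : R => 1) + id) (0 + 1) by apply: is_deriveD.
  by rewrite add0r.
have := @is_derive1_comp _ (@ln R) (fun u : R => 1 + u) x _ _
  (is_derive1_ln x10) d1.
by rewrite mulr1.
Qed.

(** Comparison with f = h', where h is C / s times (u / (1+u))^s, a function
    with values in [0, C / s].  Since f = C u^(s-1) (1+u)^(-s-1), the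
    comparison amounts to (1+u)^(s+1) <= C e^u. *)
Lemma gamma_integral_lty : (\int[mu]_(u in `]0%R, +oo[) (g u)%:E < +oo)%E.
Proof.
(* C is the maximum over u of (1+u)^(s+1) e^(-u), reached at u = s. *)
pose C := expR ((s + 1) * ln (s + 1) - s).
pose f (u : R) : R := C * expR ((s - 1) * ln u - (s + 1) * ln (1 + u)).
pose h (u : R) : R := C / s * expR (s * (ln u - ln (1 + u))).
have s10 : 0 < s + 1 by rewrite addr_gt0.
have dh (x : R) : 0 < x -> is_derive x 1 h (f x).
  move=> x0.
  have x10 : 0 < 1 + x by rewrite addr_gt0.
  have ? := is_derive1_ln x0.
  have d1 : is_derive x (1:R) (fun u : R => ln (1 + u)) (1 + x)^-1.
    exact: is_derive_ln1p.
  rewrite /h /f; apply: is_derive_eq.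
  rewrite /GRing.scale/=.
  rewrite (_ : (s - 1) * ln x - (s + 1) * ln (1 + x) =
     s * (ln x - ln (1 + x)) - ln x - ln (1 + x)); last by ring.
  rewrite 2!expRB !lnK//.
  by field; rewrite !gt_eqF.
have cf (x : R) : 0 < x -> {for x, continuous f}.
  move=> x0; apply/differentiable_continuous/derivable1_diffP.
  have x10 : 0 < 1 + x by rewrite addr_gt0.
  have ? := is_derive1_ln x0.
  have d1 : is_derive x (1:R) (fun u : R => ln (1 + u)) (1 + x)^-1.
    exact: is_derive_ln1p.
  by rewrite /f; apply: ex_derive.
apply: (@le_lt_trans _ _ (C / s)%:E); last exact: ltry.
apply: (@le_trans _ _ (\int[mu]_(u in `]0%R, +oo[) (f u)%:E)%E).
  apply: ge0_le_integral => //.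
  - by move=> x _; rewrite lee_fin mulr_ge0 ?powR_ge0 ?expR_ge0.
  - apply/measurable_EFinP; exact: measurable_gamma_integrand.
  - apply/measurable_EFinP; apply: open_continuous_measurable_fun => // x.
    by rewrite inE/= in_itv/= andbT => /cf.
  - move=> x; rewrite /= in_itv/= andbT => x0.
    rewrite lee_fin /g /f /C /powR gt_eqF// -!expRD ler_expR.
    have x10 : 0 < 1 + x by rewrite addr_gt0.
    (* ln z <= z - 1 at z = (1+x)/(s+1), the point of contact being x = s. *)
    have := @le_ln1Dx R ((1 + x) / (s + 1) - 1).
    rewrite subrKC ln_div// ?posrE// => H.
    have {}H : ln (1 + x) - ln (s + 1) <= (1 + x) / (s + 1) - 1.
      by apply: H; rewrite ltrDr divr_gt0.
    have {}H : (s + 1) * (ln (1 + x) - ln (s + 1)) <=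
               (s + 1) * ((1 + x) / (s + 1) - 1).
      by rewrite ler_pM2l.
    have E : (s + 1) * ((1 + x) / (s + 1) - 1) = x - s by field; rewrite gt_eqF.
    rewrite E in H; lra.
apply: (@integral_le_primitive_bound _ f h).
- exact: cf.
- by move=> x _; rewrite mulr_ge0 ?expR_ge0.
- move=> x x0; have Cs : 0 < C / s by rewrite divr_gt0 ?expR_gt0.
  rewrite mulr_ge0 ?expR_ge0 ?(ltW Cs)//= ger_pMr// expR_le1.
  rewrite pmulr_rle0// subr_le0 ler_ln ?posrE ?addr_gt0//.
  by rewrite lerDr.
Qed.

Lemma gamma_fin_num : (\int[mu]_(u in `]0%R, +oo[) (g u)%:E)%E = (Gamma s)%:E.
Proof.
rewrite /Gamma /Rintegral fineK// ge0_fin_numE ?gamma_integral_lty//.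
by apply: integral_ge0 => x _; rewrite lee_fin mulr_ge0 ?powR_ge0 ?expR_ge0.
Qed.

Definition logweight (x : R) : R := (- ln x) `^ (s - 1).

Lemma measurable_logweight (D : set R) : measurable_fun D logweight.
Proof.
apply: measurable_funTS; rewrite /logweight.
apply: (@measurableT_comp _ _ _ _ _ _ (fun u : R => u `^ (s - 1))).
  exact: measurable_powR.
by apply: measurableT_comp.
Qed.

(** Under x = exp (- c u) the integrand becomes
    exp (- c (p+1) u) (c u)^(s-1) c; the choice c = 1/(p+1) leaves exactly
    c^s times the integrand of Gamma. *)
Lemma logweight_moment (p : nat) :
  (\int[mu]_(x in `]0%R, 1%R[) (x ^+ p * logweight x)%:E =
   (Gamma s / p.+1%:R `^ s)%:E)%E.
Proof.
pose c : R := p.+1%:R^-1.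
have c0 : 0 < c by rewrite invr_gt0.
have l0 (x : R) : 0 < x < 1 -> 0 < - ln x.
  by move=> x01; rewrite oppr_gt0 ln_lt0.
rewrite (@substitution_exp _ c (fun x => x ^+ p * logweight x))//; first last.
- move=> x /andP[x0 x1]; rewrite mulr_ge0 ?powR_ge0 ?exprn_ge0// ltW//.
- move=> x x01; have /andP[x0 x1] := x01.
  apply: cvgM; first exact: exprn_continuous.
  apply: (@continuous_comp _ _ _ (fun x => - ln x) (fun u => u `^ (s - 1))).
    by apply: cvgN; exact: continuous_ln.
  by apply: continuous_powR; exact: l0.
transitivity (\int[mu]_(u in `]0%R, +oo[) ((c `^ s)%:E * (g u)%:E))%E.
  apply: eq_integral => u; rewrite inE/= in_itv/= andbT => u0.
  rewrite -EFinM; congr EFin.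
  rewrite /logweight /g expRK mulNr opprK powRM ?(ltW c0) ?(ltW u0)//.
  rewrite -(mulr_powRB1 (ltW c0) s0).
  rewrite [in RHS](_ : - u = (- (c * u)) *+ p + (- (c * u))); last first.
    by rewrite -mulrSr mulNrn -mulr_natl mulrA divff ?mul1r// pnatr_eq0.
  rewrite expRD -[_ *+ p]mulr_natl expRM_natl.
  by move: (expR _) (_ `^ _) (_ `^ _) => E a b; ring.
rewrite ge0_integralZl ?lee_fin ?powR_ge0//.
- rewrite gamma_fin_num -EFinM mulrC; congr (EFin (_ * _)).
  by rewrite /c -powR_inv1// -powRrM mulN1r powRN.
- apply/measurable_EFinP; exact: measurable_gamma_integrand.
- by move=> x _; rewrite lee_fin mulr_ge0 ?powR_ge0 ?expR_ge0.
Qed.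

End LogWeight.

(** * The coefficients as positive integrals *)

Section RealIntegrals.
Context {d : measure_display} {T : measurableType d} {R : realType}.
Variable mu : {measure set T -> \bar R}.

Lemma Rintegral_sum (D : set T) (I : Type) (r : seq I) (f : I -> T -> R) :
  measurable D -> (forall i, mu.-integrable D (EFin \o f i)) ->
  mu.-integrable D (EFin \o (fun x => \sum_(i <- r) f i x)) /\
  \int[mu]_(x in D) (\sum_(i <- r) f i x) =
  \sum_(i <- r) \int[mu]_(x in D) f i x.
Proof.
move=> mD fi; elim: r => [|i r [IH1 IH2]].
  rewrite big_nil (_ : (fun x : T => _) = cst 0); last first.
    by apply/funext => x; rewrite big_nil.
  split; first exact: integrable0.
  by rewrite Rintegral_cst// mul0r.
have E : (fun x => \sum_(j <- i :: r) f j x) =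
    (fun x => f i x + \sum_(j <- r) f j x).
  by apply/funext => x; rewrite big_cons.
rewrite E big_cons; split; first exact: (integrableD mD (fi i) IH1).
by rewrite RintegralD// IH2.
Qed.

(** A nonnegative function with integral 0 vanishes almost everywhere; here
    it would do so nowhere on D, so D would be a null set. *)
Lemma Rintegral_gt0 (D : set T) (f : T -> R) :
  measurable D -> (0 < mu D)%E -> mu.-integrable D (EFin \o f) ->
  (forall x, D x -> 0 < f x) -> 0 < \int[mu]_(x in D) f x.
Proof.
move=> mD D0 fi f0.
have int0 : (0 <= \int[mu]_(x in D) (f x)%:E)%E.
  by apply: integral_ge0 => x Dx; rewrite lee_fin ltW ?f0.
have fin : (\int[mu]_(x in D) (f x)%:E)%E \is a fin_num.
  exact: integrable_fin_num.
rewrite /Rintegral fine_gt0// -ge0_fin_numE// fin andbT lt0e int0 andbT.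
apply/eqP => E.
have : (\int[mu]_(x in D) `|(EFin \o f) x| = 0)%E.
  rewrite -E; apply: eq_integral => x; rewrite inE => Dx.
  by rewrite /= ger0_norm// ltW// f0.
move/(ae_eq_integral_abs _ mD (measurable_int _ fi)) => [N [mN N0 DN]].
suff : (mu D <= mu N)%E by rewrite N0 leNgt D0.
apply: le_measure; rewrite ?inE// => x Dx; apply: DN => /= /(_ Dx) [] fx0.
by have := f0 _ Dx; rewrite fx0 ltxx.
Qed.

End RealIntegrals.

Section Coefficients.
Context {R : realType}.
Local Notation mu := (@lebesgue_measure R).
Variable s : R.
Hypothesis s0 : 0 < s.

Local Notation m := (logweight s).

Lemma logweight_integrable :
  mu.-integrable (`]0, 1[ : set R) (EFin \o m).
Proof.
apply/integrableP; split.
  by apply/measurable_EFinP; exact: measurable_logweight.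
have := logweight_moment s0 0.
rewrite (_ : (\int[mu]_(x in _) _)%E =
    (\int[mu]_(x in `]0%R, 1%R[) `|(EFin \o m) x|)%E).
  by move=> ->; exact: ltry.
by apply: eq_integral => x _; rewrite expr0 mul1r /= ger0_norm// powR_ge0.
Qed.

Lemma bounded_mul_logweight_integrable (b : R -> R) (M : R) :
  measurable_fun (`]0, 1[ : set R) b ->
  (forall x, 0 < x < 1 -> `|b x| <= M) ->
  mu.-integrable (`]0, 1[ : set R) (EFin \o (fun x => b x * m x)).
Proof.
move=> mb bM.
have M0 : 0 <= M by apply: le_trans (bM 2^-1 _) => //; lra.
have mi : mu.-integrable (`]0, 1[ : set R) (fun x => (M%:E * (m x)%:E))%E.
  by apply: integrableZl => //; exact: logweight_integrable.
apply: le_integrable mi => //.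
  by apply/measurable_EFinP/measurable_funM => //; exact: measurable_logweight.
move=> x; rewrite /= in_itv/= => x01.
by rewrite lee_fin !normrM ler_wpM2r// (le_trans (bM _ x01))// ler_norm.
Qed.

Lemma measurable_polynomial_weight (n : nat) (D : set R) :
  measurable_fun D (fun x : R => x ^+ 2 * (1 - x ^+ 2) ^+ n).
Proof.
apply: measurable_funTS; apply: continuous_measurable_fun => x.
apply: cvgM; first exact: exprn_continuous.
apply: (@continuous_comp _ _ _ (fun x : R => 1 - x ^+ 2) (fun u : R => u ^+ n)).
  by apply: cvgB; [exact: cvg_cst|exact: exprn_continuous].
exact: exprn_continuous.
Qed.

Lemma polynomial_weight_itv (n : nat) (x : R) : 0 < x < 1 ->
  0 < x ^+ 2 * (1 - x ^+ 2) ^+ n <= 1.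
Proof.
move=> /andP[x0 x1].
have x21 : x ^+ 2 < 1 by rewrite expr_lt1// ltW.
have x20 : 0 < x ^+ 2 by rewrite exprn_gt0.
rewrite mulr_gt0 ?exprn_gt0 ?subr_gt0//=.
have y0 : 0 <= 1 - x ^+ 2 by rewrite subr_ge0 ltW.
have y1 : 1 - x ^+ 2 <= 1 by rewrite gerBl ltW.
by apply: mulr_ile1; rewrite ?(ltW x20) ?(ltW x21) ?exprn_ge0 ?exprn_ile1.
Qed.

Lemma polynomial_weight_integrable (n : nat) :
  mu.-integrable (`]0, 1[ : set R)
    (EFin \o (fun x => x ^+ 2 * (1 - x ^+ 2) ^+ n * m x)).
Proof.
apply: (@bounded_mul_logweight_integrable _ 1).
  exact: measurable_polynomial_weight.
by move=> x /(polynomial_weight_itv n) /andP[h1 h2]; rewrite gtr0_norm.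
Qed.

Lemma lebesgue_measure_unit_gt0 : (0 < mu `]0%R, 1%R[)%E.
Proof. by rewrite lebesgue_measure_itv/= lte_fin ltr01 sube0 lte_fin. Qed.

Lemma logweight_integral : \int[mu]_(x in `]0, 1[) m x = Gamma s.
Proof.
have := logweight_moment s0 0; rewrite powR1 divr1 => h.
rewrite /Rintegral -[RHS]/(fine (Gamma s)%:E) -h; congr fine.
by apply: eq_integral => x _; rewrite expr0 mul1r.
Qed.

Lemma logweight_gt0 (x : R) : 0 < x < 1 -> 0 < m x.
Proof. by move=> x01; rewrite /logweight powR_gt0// oppr_gt0 ln_lt0. Qed.

Lemma Gamma_gt0 : 0 < Gamma s.
Proof.
rewrite -logweight_integral; apply: Rintegral_gt0 => //.
- exact: lebesgue_measure_unit_gt0.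
- exact: logweight_integrable.
- by move=> x /=; rewrite in_itv/=; exact: logweight_gt0.
Qed.

Lemma monomial_integrable (p : nat) :
  mu.-integrable (`]0, 1[ : set R) (EFin \o (fun x => x ^+ p * m x)).
Proof.
apply: (@bounded_mul_logweight_integrable _ 1).
  by apply: measurable_funTS; exact: measurable_funX.
move=> x /andP[x0 x1]; rewrite ger0_norm ?exprn_ge0 ?exprn_ile1// ltW//.
Qed.

Lemma Rlogweight_moment (p : nat) :
  \int[mu]_(x in `]0, 1[) (x ^+ p * m x) = Gamma s / p.+1%:R `^ s.
Proof. by rewrite /Rintegral logweight_moment. Qed.

(** The binomial expansion of (1 - x^2)^n, integrated term by term with the
    moments of order 2 i + 2.  The index is shifted: i stands for k - 1. *)
Lemma q_integral (n : nat) :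
  q s n.+1 = (Gamma s)^-1 *
    \int[mu]_(x in `]0, 1[) (x ^+ 2 * (1 - x ^+ 2) ^+ n * m x).
Proof.
pose f (i : nat) (x : R) : R :=
  ((-1) ^+ i *+ 'C(n, i)) * (x ^+ (2 * i.+1) * m x).
have fi i : mu.-integrable (`]0, 1[ : set R) (EFin \o f i).
  have h : mu.-integrable (`]0, 1[ : set R) (fun x =>
      ((-1) ^+ i *+ 'C(n, i))%:E * (x ^+ (2 * i.+1) * m x)%:E)%E.
    by apply: integrableZl => //; exact: monomial_integrable.
  exact: h.
transitivity ((Gamma s)^-1 *
    \int[mu]_(x in `]0, 1[) \sum_(i <- iota 0 n.+1) f i x); last first.
  congr (_ * _); apply: eq_Rintegral => x _.
  rewrite -(subn0 n.+1) -/(index_iota 0 n.+1) big_mkord exprBn.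
  rewrite mulr_sumr mulr_suml; apply: eq_bigr => i _; rewrite /f.
  rewrite expr1n mulr1 mulnS exprD exprM mulrnAr !mulrnAl; congr (_ *+ _).
  by move: ((x ^+ 2) ^+ i) (x ^+ 2) ((-1) ^+ i) (m x) => a b c d; ring.
have [_ ->] := @Rintegral_sum _ _ R mu _ _ (iota 0 n.+1) f
  (measurable_itv _) fi.
rewrite /q mulr_sumr big_add1/= -(subn0 n.+1) -/(index_iota 0 n.+1).
rewrite /index_iota subn0; apply: eq_bigr => i _.
rewrite RintegralZl//; last exact: monomial_integrable.
rewrite Rlogweight_moment addn1 -mulr_natr.
have := Gamma_gt0; move: (Gamma s) => G G0.
have : 0 < (2 * i.+1).+1%:R `^ s by rewrite powR_gt0.
move: (_ `^ s) => P P0; rewrite -[i.+2]addn2 exprD sqrrN expr1n mulr1.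
by field; rewrite !gt_eqF.
Qed.

Lemma q_gt0 (n : nat) : 0 < q s n.+1.
Proof.
rewrite q_integral mulr_gt0 ?invr_gt0 ?Gamma_gt0//.
apply: Rintegral_gt0 => //.
- exact: lebesgue_measure_unit_gt0.
- exact: polynomial_weight_integrable.
- move=> x /=; rewrite in_itv/= => x01.
  have /andP[h _] := polynomial_weight_itv n x01.
  by rewrite mulr_gt0// logweight_gt0.
Qed.

End Coefficients.

(** * Integrals of complex-valued functions *)

Section ComplexIntegrals.
Context {R : realType}.
Local Notation mu := (@lebesgue_measure R).
(* [measurableTypeR R] is the copy of R that carries the Borel sets on which
   the Lebesgue measure is defined. *)
Implicit Types (D : set (measurableTypeR R)) (f g : R -> R[i]) (z : R[i]).

Definition Cintegrable D f :=
  mu.-integrable D (EFin \o (fun x => complex.Re (f x))) /\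
  mu.-integrable D (EFin \o (fun x => complex.Im (f x))).

Definition Cmeasurable D f :=
  measurable_fun D (fun x => complex.Re (f x)) /\
  measurable_fun D (fun x => complex.Im (f x)).

Lemma ReB z1 z2 : complex.Re (z1 - z2) = complex.Re z1 - complex.Re z2.
Proof. by case: z1 z2 => [a b] [c d]. Qed.

Lemma ImB z1 z2 : complex.Im (z1 - z2) = complex.Im z1 - complex.Im z2.
Proof. by case: z1 z2 => [a b] [c d]. Qed.

Lemma ReM z1 z2 : complex.Re (z1 * z2) =
  complex.Re z1 * complex.Re z2 - complex.Im z1 * complex.Im z2.
Proof. by case: z1 z2 => [a b] [c d]. Qed.

Lemma ImM z1 z2 : complex.Im (z1 * z2) =
  complex.Re z1 * complex.Im z2 + complex.Im z1 * complex.Re z2.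
Proof. by case: z1 z2 => [a b] [c d]. Qed.

Lemma normr_Re_Im_le z (M : R) : `|z| <= M%:C ->
  `|complex.Re z| <= M /\ `|complex.Im z| <= M.
Proof.
rewrite normc_def lecR => h.
by split; apply: le_trans h; rewrite -sqrtr_sqr ler_sqrt ?addr_ge0 ?sqr_ge0//
  ?lerDl ?lerDr ?sqr_ge0.
Qed.

Lemma normr_le_Re_Im (a b M : R) : `|a| <= M -> `|b| <= M ->
  `|a +i* b| <= (2 * M)%:C.
Proof.
move=> aM bM; have M0 := le_trans (normr_ge0 _) aM.
rewrite normc_def lecR /= -[leRHS]ger0_norm ?mulr_ge0// -sqrtr_sqr.
rewrite ler_sqrt ?sqr_ge0//.
rewrite -(real_normK (num_real a)) -(real_normK (num_real b)).
have : `|a| ^+ 2 <= M ^+ 2 by rewrite ler_sqr ?nnegrE.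
have : `|b| ^+ 2 <= M ^+ 2 by rewrite ler_sqr ?nnegrE.
by move: (sqr_ge0 M); rewrite exprMn; lra.
Qed.

Lemma Cmeasurable_real D (a : R -> R) :
  measurable_fun D a -> Cmeasurable D (fun x => (a x)%:C).
Proof. by move=> ma; split => //=; exact: measurable_cst. Qed.

Lemma Cmeasurable_cst D z : Cmeasurable D (fun=> z).
Proof. by split; exact: measurable_cst. Qed.

Lemma CmeasurableB D f g : Cmeasurable D f -> Cmeasurable D g ->
  Cmeasurable D (fun x => f x - g x).
Proof.
move=> [f1 f2] [g1 g2]; split.
  by under eq_fun do rewrite ReB; exact: measurable_funB.
by under eq_fun do rewrite ImB; exact: measurable_funB.
Qed.

Lemma CmeasurableM D f g : Cmeasurable D f -> Cmeasurable D g ->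
  Cmeasurable D (fun x => f x * g x).
Proof.
move=> [f1 f2] [g1 g2]; split.
  under eq_fun do rewrite ReM.
  by apply: measurable_funB; exact: measurable_funM.
under eq_fun do rewrite ImM.
by apply: measurable_funD; exact: measurable_funM.
Qed.

(** The real inverse u^-1 enters as the power u^(-1) of the squared modulus,
    which agrees with it because the squared modulus is nonnegative; both
    conventions give 0 at 0. *)
Lemma CmeasurableV D f : Cmeasurable D f -> Cmeasurable D (fun x => (f x)^-1).
Proof.
move=> [f1 f2].
pose n2 x := complex.Re (f x) ^+ 2 + complex.Im (f x) ^+ 2.
have mn : measurable_fun D (fun x => (n2 x)^-1).
  rewrite (_ : (fun x => _) = (fun x => n2 x `^ (-1))); last first.
    by apply/funext => x; rewrite powR_inv1// addr_ge0 ?sqr_ge0.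
  apply: (@measurableT_comp _ _ _ _ _ _ (fun u : R => u `^ (-1)) _ n2).
    exact: measurable_powR.
  by apply: measurable_funD; exact: measurable_funX.
split.
  rewrite (_ : (fun x => _) = (fun x => complex.Re (f x) * (n2 x)^-1)).
    exact: measurable_funM.
  by apply/funext => x; rewrite /n2; case: (f x).
rewrite (_ : (fun x => _) = (fun x => - (complex.Im (f x) * (n2 x)^-1))).
  by apply: measurableT_comp => //; exact: measurable_funM.
by apply/funext => x; rewrite /n2; case: (f x).
Qed.

Lemma CintegralB D f g : measurable D -> Cintegrable D f -> Cintegrable D g ->
  Cintegral D (fun x => f x - g x) = Cintegral D f - Cintegral D g.
Proof.
move=> mD [f1 f2] [g1 g2]; rewrite /Cintegral.
have -> : (fun x => complex.Re (f x - g x)) =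
          (fun x => complex.Re (f x) - complex.Re (g x)).
  by apply/funext => x; rewrite ReB.
have -> : (fun x => complex.Im (f x - g x)) =
          (fun x => complex.Im (f x) - complex.Im (g x)).
  by apply/funext => x; rewrite ImB.
by rewrite !RintegralB.
Qed.

Lemma CintegralZ D z (a : R -> R) : measurable D ->
  mu.-integrable D (EFin \o a) ->
  Cintegral D (fun x => z * (a x)%:C) = z * (\int[mu]_(x in D) a x)%:C.
Proof.
move=> mD ia; case: z => u v; rewrite /Cintegral.
have -> : (fun x => complex.Re ((u +i* v) * (a x)%:C)) = (fun x => u * a x).
  by apply/funext => x; rewrite ReM /= mulr0 subr0.
have -> : (fun x => complex.Im ((u +i* v) * (a x)%:C)) = (fun x => v * a x).
  by apply/funext => x; rewrite ImM /= mulr0 add0r.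
rewrite !RintegralZl//.
by apply/eqP; rewrite eq_complex/= !mulr0 subr0 add0r !eqxx.
Qed.

(** Bounding the real and imaginary parts separately costs the factor 2, which
    spares the rotation argument of the sharp triangle inequality. *)
Lemma Cintegral_le D f (b : R -> R) : measurable D -> Cintegrable D f ->
  mu.-integrable D (EFin \o b) ->
  (forall x, D x -> `|f x| <= (b x)%:C) ->
  `|Cintegral D f| <= (2 * \int[mu]_(x in D) b x)%:C.
Proof.
move=> mD [f1 f2] ib fb; apply: normr_le_Re_Im.
  apply: le_trans (le_normr_Rintegral mD f1) _.
  apply: le_Rintegral => //; first exact: (integrable_norm f1).
  by move=> x /fb /normr_Re_Im_le[].
apply: le_trans (le_normr_Rintegral mD f2) _.
apply: le_Rintegral => //; first exact: (integrable_norm f2).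
by move=> x /fb /normr_Re_Im_le[].
Qed.

Lemma le_Cintegrable D f (b : R -> R) : measurable D -> Cmeasurable D f ->
  mu.-integrable D (EFin \o b) ->
  (forall x, D x -> `|f x| <= (b x)%:C) -> Cintegrable D f.
Proof.
move=> mD [f1 f2] ib fb; split; apply: le_integrable ib => //.
- exact/measurable_EFinP.
- move=> x /fb /normr_Re_Im_le[h _]; rewrite lee_fin.
  exact: le_trans h (ler_norm _).
- exact/measurable_EFinP.
- move=> x /fb /normr_Re_Im_le[_ h]; rewrite lee_fin.
  exact: le_trans h (ler_norm _).
Qed.

End ComplexIntegrals.

(** * The geometric expansion of H *)

Section GeometricTail.
Context {R : realType}.
Local Notation mu := (@lebesgue_measure R).
Variables (s : R) (w : R[i]).
Hypotheses (s0 : 0 < s) (w1 : `|w| < 1).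

Local Notation m := (logweight s).
Let r : R := complex.Re `|w|.

Let rE : `|w| = r%:C.
Proof. by rewrite /r normc_def. Qed.

Let r0 : 0 <= r.
Proof. by rewrite -lecR -rE normr_ge0. Qed.

Let r1 : r < 1.
Proof. by rewrite -ltcR -rE. Qed.

(** The remainder of the expansion of w x^2 / (1 - w (1 - x^2)) in powers of
    w, once the powers up to w^n are removed. *)
Definition geometric_tail (n : nat) (x : R) : R[i] :=
  w ^+ n.+1 * (x ^+ 2 * (1 - x ^+ 2) ^+ n)%:C / (1 - w * (1 - x ^+ 2)%:C).

(** The weight 1 - x^2 lies in [0, 1], so |w (1 - x^2)| <= |w|: the bound is
    uniform in x. *)
Lemma norm_denominator (x : R) : 0 < x < 1 ->
  (1 - r)%:C <= `|1 - w * (1 - x ^+ 2)%:C|.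
Proof.
move=> /andP[x0 x1].
have x20 : 0 <= x ^+ 2 by rewrite exprn_ge0// ltW.
have x21 : x ^+ 2 <= 1 by rewrite exprn_ile1// ltW.
have h : `|w * (1 - x ^+ 2)%:C| <= r%:C.
  rewrite normrM rE ger0_norm ?ler0c ?subr_ge0// -rmorphM lecR.
  by rewrite ler_piMr// gerBl.
apply: le_trans (lerB_dist _ _).
by rewrite normr1 rmorphB rmorph1 lerD2l lerN2.
Qed.

Lemma denominator_neq0 (x : R) : 0 < x < 1 -> 1 - w * (1 - x ^+ 2)%:C != 0.
Proof.
move=> /norm_denominator h; rewrite -normr_gt0 (lt_le_trans _ h)//.
by rewrite ltcR subr_gt0.
Qed.

Lemma geometric_tailB (n : nat) (x : R) : 0 < x < 1 ->
  geometric_tail n x - geometric_tail n.+1 x =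
  w ^+ n.+1 * (x ^+ 2 * (1 - x ^+ 2) ^+ n)%:C.
Proof.
move=> /denominator_neq0; rewrite rmorphB rmorph1.
rewrite /geometric_tail [w ^+ n.+2]exprS [(1 - x ^+ 2) ^+ n.+1]exprS.
move: (w ^+ n.+1) ((1 - x ^+ 2) ^+ n) (x ^+ 2) => c b a d.
by field; exact: d.
Qed.

Lemma F_kernelE (x : R) : 0 < x < 1 ->
  (1 + w / (1 - w) * (x ^+ 2)%:C)^-1 = 1 - geometric_tail 0 x.
Proof.
move=> x01; have := denominator_neq0 x01.
rewrite /geometric_tail expr1 expr0 mulr1 rmorphB rmorph1.
have : 1 - w != 0.
  by rewrite subr_eq0; apply/eqP => E; move: w1; rewrite -E normr1 ltxx.
move: (x ^+ 2) => a h1 h2.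
have -> : 1 + w / (1 - w) * a%:C = (1 - w * (1 - a%:C)) / (1 - w) by field.
rewrite invf_div; apply: (mulIf h2).
by rewrite divfK// [RHS]mulrBl divfK// mul1r; ring.
Qed.

Lemma norm_geometric_tail (n : nat) (x : R) : 0 < x < 1 ->
  `|geometric_tail n x| <= (r ^+ n.+1 / (1 - r))%:C.
Proof.
move=> x01; have h := norm_denominator x01.
have /andP[p0 p1] := polynomial_weight_itv n x01.
have r10 : 0 < 1 - r by rewrite subr_gt0.
have d0 : 0 < `|1 - w * (1 - x ^+ 2)%:C| by rewrite normr_gt0 denominator_neq0.
rewrite /geometric_tail !normrM normrX rE normfV fmorph_div rmorphXn.
apply: ler_pM.
- by rewrite mulr_ge0 ?exprn_ge0// ler0c.
- by rewrite invr_ge0.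
- rewrite ger0_norm ?ler0c ?(ltW p0)// -rmorphXn -rmorphM lecR.
  by rewrite ler_piMr ?exprn_ge0.
- by rewrite lef_pV2 ?posrE// ltcR.
Qed.

Let D : set (measurableTypeR R) := `]0, 1[.

Let mD : measurable D.
Proof. exact: measurable_itv. Qed.

Lemma Cmeasurable_geometric_tail (n : nat) : Cmeasurable D (geometric_tail n).
Proof.
apply: CmeasurableM.
  apply: CmeasurableM; first exact: Cmeasurable_cst.
  by apply: Cmeasurable_real; exact: measurable_polynomial_weight.
apply: CmeasurableV; apply: CmeasurableB; first exact: Cmeasurable_cst.
apply: CmeasurableM; first exact: Cmeasurable_cst.
apply: Cmeasurable_real; apply: measurable_funB; first exact: measurable_cst.
exact: measurable_funX.
Qed.

Let weighted_tail (n : nat) (x : R) : R[i] := geometric_tail n x * (m x)%:C.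

Let bound_integrable (n : nat) :
  mu.-integrable D (EFin \o (fun x => r ^+ n.+1 / (1 - r) * m x)).
Proof.
have h : mu.-integrable D (fun x => (r ^+ n.+1 / (1 - r))%:E * (m x)%:E)%E.
  by apply: integrableZl => //; exact: logweight_integrable.
exact: h.
Qed.

Let weighted_tail_le (n : nat) (x : R) : D x ->
  `|weighted_tail n x| <= (r ^+ n.+1 / (1 - r) * m x)%:C.
Proof.
rewrite /D /= in_itv/= => x01.
have m0 : 0 <= m x by exact: powR_ge0.
rewrite /weighted_tail normrM rmorphM (@ger0_norm _ (m x)%:C) ?ler0c//.
by apply: ler_wpM2r; [rewrite ler0c | exact: norm_geometric_tail].
Qed.

Let weighted_tail_integrable (n : nat) : Cintegrable D (weighted_tail n).
Proof.
apply: le_Cintegrable (bound_integrable n) _ => //; last exact: weighted_tail_le.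
apply: CmeasurableM; first exact: Cmeasurable_geometric_tail.
by apply: Cmeasurable_real; exact: measurable_logweight.
Qed.

Lemma eq_Cintegral (f g : R -> R[i]) : (forall x, D x -> f x = g x) ->
  Cintegral D f = Cintegral D g.
Proof.
move=> fg; rewrite /Cintegral; congr (_ +i* _); apply: eq_Rintegral => x;
  by rewrite inE => /fg ->.
Qed.

Let tail_integral n := Cintegral D (weighted_tail n).

Lemma tail_integralB (n : nat) :
  tail_integral n - tail_integral n.+1 =
  (Gamma s)%:C * ((q s n.+1)%:C * w ^+ n.+1).
Proof.
rewrite /tail_integral -CintegralB//.
rewrite (@eq_Cintegral _ (fun x => w ^+ n.+1 *
    (x ^+ 2 * (1 - x ^+ 2) ^+ n * m x)%:C)); last first.
  rewrite /D => x; rewrite /= in_itv/= => x01.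
  by rewrite /weighted_tail -mulrBl geometric_tailB// [in RHS]rmorphM mulrA.
rewrite CintegralZ//; last exact: polynomial_weight_integrable.
rewrite q_integral// rmorphM fmorphV.
have : (Gamma s)%:C != 0 by rewrite gt_eqF// ltcR Gamma_gt0.
by move=> G0; rewrite -mulrA mulVKf// mulrC.
Qed.

(** Consecutive remainders differ by one term of the series, so the partial
    sums telescope. *)
Lemma partial_sumE (n : nat) :
  \sum_(1 <= k < n.+1) (q s k)%:C * w ^+ k =
  ((Gamma s)^-1)%:C * (tail_integral 0 - tail_integral n).
Proof.
have G0 : (Gamma s)%:C != 0.
  by rewrite gt_eqF// ltcR Gamma_gt0.
elim: n => [|n IH]; first by rewrite big_geq// subrr mulr0.
rewrite big_nat_recr//= IH.
have -> : tail_integral 0 - tail_integral n.+1 =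
  (tail_integral 0 - tail_integral n) +
  (tail_integral n - tail_integral n.+1) by ring.
rewrite tail_integralB [RHS]mulrDr; congr (_ + _).
by rewrite fmorphV mulKf.
Qed.

Lemma norm_tail_integral (n : nat) :
  `|tail_integral n| <= (Gamma s * (2 * r / (1 - r)) * r ^+ n)%:C.
Proof.
apply: le_trans (Cintegral_le mD (weighted_tail_integrable n)
  (bound_integrable n) (@weighted_tail_le n)) _.
rewrite lecR RintegralZl//; last exact: logweight_integrable.
rewrite logweight_integral// exprS le_eqVlt; apply/orP; left; apply/eqP.
by move: (Gamma s) (r ^+ n) (1 - r)^-1 => a b c; ring.
Qed.

Lemma H_tail_integral : H s w = 1 - ((Gamma s)^-1)%:C * tail_integral 0.
Proof.
have G0 : (Gamma s)%:C != 0 by rewrite gt_eqF// ltcR Gamma_gt0.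
rewrite /H /F; transitivity (((Gamma s)^-1)%:C *
    ((Gamma s)%:C - tail_integral 0)); last first.
  by rewrite mulrBr fmorphV mulVf.
congr (_ * _).
have mi : Cintegrable D (fun x => (m x)%:C).
  split; first exact: logweight_integrable.
  by rewrite (_ : EFin \o _ = cst 0%E)//; exact: integrable0.
rewrite (_ : (Gamma s)%:C = Cintegral D (fun x => (m x)%:C)); last first.
  rewrite /Cintegral logweight_integral//; congr (_ +i* _).
  by rewrite Rintegral_cst// mul0r.
rewrite -CintegralB//; apply: eq_Cintegral => x; rewrite /D /= in_itv/= => x01.
by rewrite F_kernelE// /weighted_tail mulrBr mulr1 [_ * geometric_tail _ _]mulrC.
Qed.

Lemma partial_sum_cvg :
  (fun N : nat => \sum_(1 <= k < N) (q s k)%:C * w ^+ k : R[i]^o) @ \oo -->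
  (((Gamma s)^-1)%:C * tail_integral 0 : R[i]^o).
Proof.
rewrite -cvg_shiftS; apply/cvgrPdist_le => e e0.
(* The order of R[i] makes a positive e a real number. *)
have [d eE] : exists d, e = d%:C by apply/complex_realP/gtr0_real.
have d0 : 0 < d by rewrite -ltcR -eE.
have /cvgrPdist_le/(_ d d0) : geometric (2 * r / (1 - r)) r @ \oo --> (0 : R).
  by apply: cvg_geometric; rewrite ger0_norm.
apply: filterS => n; rewrite /= sub0r normrN => h.
rewrite partial_sumE mulrBr opprB addrC subrK normrM.
have G0 := Gamma_gt0 s0.
rewrite ger0_norm ?ler0c ?invr_ge0 ?(ltW G0)// eE.
apply: (@le_trans _ _ (((Gamma s)^-1)%:C *
    (Gamma s * (2 * r / (1 - r)) * r ^+ n)%:C)).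
  by rewrite ler_wpM2l ?norm_tail_integral// ler0c invr_ge0 ltW.
rewrite -rmorphM lecR -[Gamma s * _ * _]mulrA mulKf ?gt_eqF//.
by apply: le_trans h; exact: ler_norm.
Qed.

End GeometricTail.

Theorem theorem3p1 (R : realType) (s : R) (hs : 0 < s) :
  (forall w : R[i], `|w| < 1 ->
     let S := fun N : nat => \sum_(1 <= n < N) (q s n)%:C * w ^+ n : R[i]^o in
     cvgn S /\ H s w = 1 - limn S) /\
  (forall n : nat, (1 <= n)%N ->
     q s n = (Gamma s)^-1 *
       \int[@lebesgue_measure R]_(x in `]0, 1[)
         (x ^+ 2 * (1 - x ^+ 2) ^+ n.-1 * (- ln x) `^ (s - 1))) /\
  (forall n : nat, (1 <= n)%N -> 0 < q s n).
Proof.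
split; last split.
- move=> w w1 S; have S_cvg := partial_sum_cvg hs w1.
  split; first by apply/cvg_ex; eexists; exact: S_cvg.
  rewrite (H_tail_integral hs w1); congr (_ - _).
  by apply/esym; apply: (cvg_lim _ S_cvg); exact: norm_hausdorff.
- by case=> // n _; exact: q_integral.
- by case=> // n _; exact: q_gt0.
Qed.
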